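(* For $s\in\{1,2\}$ let $G_n^{2,s}$ be the graph obtained from $n$ disjoint $4$-cycles, the $i$-th having vertices $v_{i,1},v_{i,2},v_{i,3},v_{i,4}$ and edges $v_{i,1}v_{i,2},v_{i,2}v_{i,3},v_{i,3}v_{i,4},v_{i,1}v_{i,4}$, by adding the edge $v_{i,s+1}v_{i+1,1}$ for $i=1,\dots,n-1$. Then $$\lim_{n\to\infty}\mathcal{I}(G_n^{2,1})=\frac{6r^2+r+10}{2(3r^2+2r+6)},\qquad r=1+\sqrt[3]{\frac{45+\sqrt{1257}}{18}}+\sqrt[3]{\frac{45-\sqrt{1257}}{18}},$$ and $$\lim_{n\to\infty}\mathcal{I}(G_n^{2,2})=\frac{5r'+6}{2(3r'+4)},\qquad r'=\frac{3+\sqrt{17}}{2}.$$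
   Context: For a finite simple graph $G$: a matching is a set of pairwise vertex-disjoint edges; it is maximal if not contained in a larger matching. $\nu(G)$ is the maximum matching size, $\mathcal{T}_0(G)$ the number of maximal matchings, $\mathcal{T}_1(G)$ the sum of the sizes of all maximal matchings, and $\mathcal{I}(G)=\frac{\mathcal{T}_1(G)}{\nu(G)\mathcal{T}_0(G)}$ (equal to $1$ by convention if $\nu(G)=0$). *)

(* Defs.v *)
From mathcomp Require Import all_boot all_order all_algebra.
From mathcomp Require Import reals.
Set Implicit Arguments.
Unset Strict Implicit.
Unset Printing Implicit Defensive.
Import Order.TTheory GRing.Theory Num.Theory.

Record sgraph := SGraph {
  vertex :> finType;
  adj : rel vertex;
  adj_sym : symmetric adj;
  adj_irr : irreflexive adj }.

Definition edges (G : sgraph) : {set {set G}} :=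
  [set e : {set G} | [exists x, exists y, adj x y && (e == [set x; y])]].

Definition matching (G : sgraph) (M : {set {set G}}) : bool :=
  (M \subset edges G) && trivIset M.

Definition maximal_matching (G : sgraph) (M : {set {set G}}) : bool :=
  maxset (@matching G) M.

Definition nu (G : sgraph) : nat :=
  \max_(M : {set {set G}} | matching M) #|M|.

Definition T0 (G : sgraph) : nat :=
  #|[set M : {set {set G}} | maximal_matching M]|.

Definition T1 (G : sgraph) : nat :=
  \sum_(M : {set {set G}} | maximal_matching M) #|M|.

(* The invariant I(G). *)
Definition avg_ratio (R : realType) (G : sgraph) : R :=
  if nu G == 0 then 1%R else ((T1 G)%:R / ((nu G)%:R * (T0 G)%:R))%R.

(* All indices are shifted down by one: (i, j) stands for the vertex
   v_{i+1,j+1}.  Each edge is listed in one orientation only. *)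
Definition C4chain_arc (s n : nat) (u v : 'I_n * 'I_4) : bool :=
  (u.1 == v.1) &&
    ((u.2 : nat, v.2 : nat) \in [:: (0, 1); (1, 2); (2, 3); (0, 3)])
  || [&& u.1.+1 == v.1, u.2 == s :> nat & v.2 == 0 :> nat].

Definition C4chain_adj (s n : nat) : rel ('I_n * 'I_4) :=
  fun u v => C4chain_arc s u v || C4chain_arc s v u.

Lemma C4chain_adj_sym (s n : nat) : symmetric (@C4chain_adj s n).
Proof. by move=> u v; rewrite /C4chain_adj orbC. Qed.

Lemma C4chain_adj_irr (s n : nat) : irreflexive (@C4chain_adj s n).
Proof.
move=> [i j]; rewrite /C4chain_adj orbb /C4chain_arc /= eqxx /=.
rewrite gtn_eqF // orbF.
by case: j => [] [|[|[|[|]]]].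
Qed.

(* The graph G_n^{2,s}. *)
Definition C4chain (s n : nat) : sgraph :=
  SGraph (@C4chain_adj_sym s n) (@C4chain_adj_irr s n).

(* Main.v *)
(** Cutting the chain between consecutive 4-cycles, a set of edges becomes a word
    whose letters record the edges of one cycle and of the link leaving it.
    Being a maximal matching is a condition on consecutive letters, so the
    numbers [Y n] of maximal matchings and [P n] of edges in them obey a transfer
    recursion: [Y] satisfies a linear recurrence with characteristic polynomial
    [x^3 - 3x^2 - x - 2] for [s = 1] and [x^2 - 3x - 2] for [s = 2], and [P]
    satisfies the same recurrence with a forcing term linear in [Y].  The other
    characteristic roots are dominated by the real root [r], hence [Y n / r^n]
    converges and [P n / r^n] grows linearly in [n].  Since [nu = 2n], the ratio
    of the two leading terms gives the limit. *)

Require Import Defs.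
From HB Require Import structures.
From mathcomp Require Import all_boot all_order all_algebra.
From mathcomp Require Import zify.
Set Implicit Arguments.
Unset Strict Implicit.
Unset Printing Implicit Defensive.

(** * Local criteria for matchings and maximal matchings *)

(** Trades disjointness of edges for a degree bound at each vertex, which can be tested one cycle at
    a time. *)
Lemma matchingE (G : sgraph) (M : {set {set G}}) :
  matching M = (M \subset edges G) &&
    [forall v, #|[set e in M | v \in e]| <= 1].
Proof.
rewrite /matching; congr (_ && _); apply/trivIsetP/forallP => [tM v|M1 A B AM BM nAB].
  apply/card_le1_eqP => A B; rewrite !inE => /andP[AM vA] /andP[BM vB].
  apply/eqP/negPn/negP => nAB; have /pred0P/(_ v) := tM B A BM AM nAB.
  by rewrite /= vA vB.
apply/pred0P => v /=; apply/negP => /andP[vA vB]; case/eqP: nAB.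
by apply: (card_le1_eqP (M1 v)); rewrite !inE ?AM ?BM.
Qed.

(** An edge with both ends uncovered could be added to [M]. Conversely, an edge of a larger matching
    [B] has a covered end, so it meets an edge of [M], and two edges of [B] that meet are equal. *)
Lemma maximal_matchingE (G : sgraph) (M : {set {set G}}) :
  maximal_matching M = matching M &&
    [forall x, forall y, adj x y ==> (x \in cover M) || (y \in cover M)].
Proof.
apply/maxsetP/andP => [[mM maxM]|[mM domM]]; split=> //.
  apply/forallP => x; apply/forallP => y; apply/implyP => xy.
  apply/negPn/negP; rewrite negb_or => /andP[xM yM].
  have nM e : e \in M -> (x \notin e) * (y \notin e).
    by move=> eM; split; apply/negP => h; [case/negP: xM|case/negP: yM];
      apply/bigcupP; exists e.
  have /andP[sM tM] := mM.
  have exy : [set x; y] \in M.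
    rewrite -(maxM ([set x; y] |: M)) ?setU11 ?subsetUr //.
    apply/andP; split.
      rewrite subUset sM andbT sub1set inE; apply/existsP; exists x.
      by apply/existsP; exists y; rewrite xy eqxx.
    have dj B : B \in M -> [disjoint [set x; y] & B].
      move=> BM; rewrite disjoints_subset; apply/subsetP => z; rewrite !inE.
      by have [hx hy] := nM B BM; case/orP => /eqP ->.
    apply/trivIsetP => A B /setU1P[->|AM] /setU1P[->|BM] nAB.
    - by rewrite eqxx in nAB.
    - exact: dj.
    - by rewrite disjoint_sym dj.
    - exact: (trivIsetP tM).
  by have [] := nM _ exy; rewrite !inE eqxx.
move=> B /andP[sB tB] sMB; apply/eqP; rewrite eqEsubset sMB andbT.
apply/subsetP => e eB; have := subsetP sB e eB; rewrite inE.
case/existsP => x /existsP[y /andP[xy /eqP ee]].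
suff [f fM [z zf ze]] : exists2 f, f \in M & exists2 z, z \in f & z \in e.
  have -> // : e = f; apply/eqP/negPn/negP => nef.
  have /pred0P/(_ z) := trivIsetP tB _ _ eB (subsetP sMB _ fM) nef.
  by rewrite /= zf ze.
have := implyP (forallP (forallP domM x) y) xy.
case/orP => /bigcupP[f fM zf]; exists f => //.
  by exists x => //; rewrite ee !inE eqxx.
by exists y => //; rewrite ee !inE eqxx orbT.
Qed.

Lemma card_edge (G : sgraph) (e : {set G}) : e \in edges G -> #|e| = 2.
Proof.
rewrite inE => /existsP[x /existsP[y /andP[xy /eqP->]]]; rewrite cards2.
by have [xey|//] := eqVneq x y; rewrite xey adj_irr in xy.
Qed.

Lemma card_matching_le (G : sgraph) (M : {set {set G}}) :
  matching M -> (#|M|.*2 <= #|G|).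
Proof.
case/andP => sM /eqP tM; rewrite (leq_trans _ (max_card (mem (cover M)))) //.
rewrite -tM (eq_bigr (fun=> 2)) ?sum_nat_const ?muln2 // => e eM.
by rewrite card_edge ?(subsetP sM).
Qed.

(** * Words of blocks and their transfer recursion *)

(* Bits 0-3 are the cycle edges [j, j+1 mod 4]; bit 4 is the link leaving the
   cycle from vertex [s]. *)
Definition block := (bool * bool * bool * bool * bool)%type.

Definition bit (b : block) (k : nat) : bool :=
  let: (e0, e1, e2, e3, l) := b in nth false [:: e0; e1; e2; e3; l] k.

Definition block_size (b : block) : nat :=
  bit b 0 + bit b 1 + bit b 2 + bit b 3 + bit b 4.

(* [l] tells whether the link entering the cycle at vertex 0 is used. *)
Definition block_deg (s : nat) (l : bool) (b : block) (j : nat) : nat :=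
  bit b j + bit b ((j + 3) %% 4) + (j == s) * bit b 4 + (j == 0) * l.

(* Whether the link leaving the previous cycle is used, and whether its first
   endpoint is covered.  For the first cycle there is no such link; the value
   [(false, true)] then imposes no condition. *)
Definition interface := (bool * bool)%type.

(** The incoming link is passed as [false]: it ends at vertex 0, so it does not affect the degree of
    vertex [s] when [s > 0]. *)
Definition out_interface (s : nat) (b : block) : interface :=
  (bit b 4, 0 < block_deg s false b s).

(** In order: the matching property, maximality at the four cycle edges, and maximality at the
    incoming link. *)
Definition fits (s : nat) (c : interface) (b : block) : bool :=
  let deg := block_deg s c.1 b in
  [&& all (fun j => deg j <= 1) (iota 0 4),
      all (fun j => (0 < deg j) || (0 < deg (j.+1 %% 4))) (iota 0 4) &
      c.2 || (0 < deg 0)].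

(** The final test [~~ c.1] forbids a link leaving the last cycle. *)
Fixpoint good_word (s : nat) (c : interface) (w : seq block) : bool :=
  if w is b :: w' then fits s c b && good_word s (out_interface s b) w'
  else ~~ c.1.

Definition word_size (w : seq block) : nat := \sum_(b <- w) block_size b.

Fixpoint word_count (s n : nat) (c : interface) : nat :=
  if n is n'.+1 then
    \sum_(b : block | fits s c b) word_count s n' (out_interface s b)
  else ~~ c.1.

Fixpoint word_total (s n : nat) (c : interface) : nat :=
  if n is n'.+1 then
    \sum_(b : block | fits s c b)
      (block_size b * word_count s n' (out_interface s b)
       + word_total s n' (out_interface s b))
  else 0.

Lemma big_tuple_cons (T : finType) (n : nat) (P : pred (seq T))
    (F : seq T -> nat) :
  \sum_(w : n.+1.-tuple T | P w) F w =
  \sum_(b : T) \sum_(w : n.-tuple T | P (b :: w)) F (b :: w).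
Proof.
rewrite pair_big_dep /=.
rewrite (reindex (fun p : T * n.-tuple T => [tuple of p.1 :: p.2])) //=.
exists (fun w : n.+1.-tuple T => (thead w, [tuple of behead w])).
  by move=> [b w] _; congr (_, _); apply: val_inj.
by move=> w _; rewrite /= -tuple_eta.
Qed.

Lemma sum_tuple0 (T : finType) (P : pred (seq T)) (F : seq T -> nat) :
  \sum_(w : 0.-tuple T | P w) F w = if P [::] then F [::] else 0.
Proof.
rewrite big_mkcond (big_pred1 [tuple]) // => w.
by rewrite [w]tuple0 /= eqxx.
Qed.

Lemma word_countE s n c :
  word_count s n c = \sum_(w : n.-tuple block | good_word s c w) 1.
Proof.
elim: n c => [|n IH] c /=.
  by rewrite (sum_tuple0 (good_word s c) (fun=> 1)) /=; case: c.1.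
rewrite (big_tuple_cons _ (good_word s c) (fun=> 1)) big_mkcond /=.
by apply: eq_bigr => b _; case: (fits s c b) => /=; rewrite ?IH ?big_pred0_eq.
Qed.

Lemma word_totalE s n c :
  word_total s n c = \sum_(w : n.-tuple block | good_word s c w) word_size w.
Proof.
elim: n c => [|n IH] c /=.
  by rewrite (sum_tuple0 (good_word s c) word_size) /= /word_size big_nil if_same.
rewrite (big_tuple_cons _ (good_word s c) word_size) big_mkcond /=.
apply: eq_bigr => b _; case: (fits s c b) => /=; last by rewrite big_pred0_eq.
rewrite IH word_countE big_distrr -big_split /=.
by apply: eq_bigr => w _; rewrite muln1 /word_size big_cons.
Qed.

(** * Explicit recurrences for the two chains *)

Lemma sum_block (F : block -> nat) (P : pred block) :
  \sum_(b | P b) F b =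
  \sum_(e0 : bool) \sum_(e1 : bool) \sum_(e2 : bool) \sum_(e3 : bool)
    \sum_(l : bool) if P (e0, e1, e2, e3, l) then F (e0, e1, e2, e3, l) else 0.
Proof.
by rewrite big_mkcond !pair_bigA /=; apply: eq_bigr => -[[[[e0 e1] e2] e3] l].
Qed.

(** By enumeration of the 32 blocks. A used link covers its first endpoint, so [(true, false)] never
    arises and three interfaces close the recursion. *)
Lemma word_count1_rec n :
  [/\ word_count 1 n.+1 (true, true) =
        word_count 1 n (true, true) + word_count 1 n (false, true) +
        word_count 1 n (false, false),
      word_count 1 n.+1 (false, true) =
        2 * word_count 1 n (true, true) + 2 * word_count 1 n (false, true) &
      word_count 1 n.+1 (false, false) =
        word_count 1 n (true, true) + 2 * word_count 1 n (false, true)].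
Proof.
by split; rewrite /= sum_block !big_bool /fits /block_deg /out_interface
  /block_deg /= ?(muln0, mul1n, add0n, addn0, ltnn, ltnSn) /=; lia.
Qed.

Lemma word_total1_rec n :
  [/\ word_total 1 n.+1 (true, true) =
        word_total 1 n (true, true) + word_total 1 n (false, true) +
        word_total 1 n (false, false) + 2 * word_count 1 n (true, true) +
        word_count 1 n (false, true) + word_count 1 n (false, false),
      word_total 1 n.+1 (false, true) =
        2 * word_total 1 n (true, true) + 2 * word_total 1 n (false, true) +
        4 * word_count 1 n (true, true) + 4 * word_count 1 n (false, true) &
      word_total 1 n.+1 (false, false) =
        word_total 1 n (true, true) + 2 * word_total 1 n (false, true) +
        2 * word_count 1 n (true, true) + 4 * word_count 1 n (false, true)].
Proof.
by split; rewrite /= sum_block !big_bool /fits /block_deg /out_interface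
  /block_deg /block_size /= ?(muln0, mul1n, add0n, addn0, ltnn, ltnSn) /=; lia.
Qed.

(* The interface [(false, false)] never arises for [s = 2]: leaving vertex 2
   uncovered would force both neighbours 1 and 3 to be matched to vertex 0. *)
Lemma word_count2_rec n :
  word_count 2 n.+1 (true, true) =
    word_count 2 n (true, true) + 2 * word_count 2 n (false, true) /\
  word_count 2 n.+1 (false, true) =
    2 * word_count 2 n (true, true) + 2 * word_count 2 n (false, true).
Proof.
by split; rewrite /= sum_block !big_bool /fits /block_deg /out_interface /block_deg /=
  ?(muln0, mul1n, add0n, addn0, ltnn, ltnSn) /=; lia.
Qed.

Lemma word_total2_rec n :
  word_total 2 n.+1 (true, true) =
    word_total 2 n (true, true) + 2 * word_total 2 n (false, true) +
    word_count 2 n (true, true) + 2 * word_count 2 n (false, true) /\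
  word_total 2 n.+1 (false, true) =
    2 * word_total 2 n (true, true) + 2 * word_total 2 n (false, true) +
    4 * word_count 2 n (true, true) + 4 * word_count 2 n (false, true).
Proof.
by split; rewrite /= sum_block !big_bool /fits /block_deg /out_interface /block_deg
  /block_size /= ?(muln0, mul1n, add0n, addn0, ltnn, ltnSn) /=; lia.
Qed.

(** Elimination of the other two interfaces; the coefficients come from the characteristic
    polynomial of the 3 by 3 transfer matrix. *)
Lemma word_count1_rec3 n :
  word_count 1 n.+3 (false, true) =
    3 * word_count 1 n.+2 (false, true) +
    word_count 1 n.+1 (false, true) +
    2 * word_count 1 n (false, true).
Proof.
have [] := word_count1_rec n; have [] := word_count1_rec n.+1.
by have [] := word_count1_rec n.+2; lia.
Qed.

(** If each matching is weighted by [z] to the power of its size, the recurrence has coefficients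
    [3 z^2], [3 z^3 - 2 z^4], [2 z^5]. Differentiating it at [z = 1] gives the forcing coefficients
    6, 1, 10. *)
Lemma word_total1_rec3 n :
  word_total 1 n.+3 (false, true) =
    3 * word_total 1 n.+2 (false, true) +
    word_total 1 n.+1 (false, true) +
    2 * word_total 1 n (false, true) +
    (6 * word_count 1 n.+2 (false, true) +
    word_count 1 n.+1 (false, true) +
    10 * word_count 1 n (false, true)).
Proof.
have [] := word_count1_rec n; have [] := word_count1_rec n.+1.
have [] := word_count1_rec n.+2; have [] := word_total1_rec n.
have [] := word_total1_rec n.+1; have [] := word_total1_rec n.+2.
lia.
Qed.

Lemma word_count2_rec2 n :
  word_count 2 n.+2 (false, true) =
    3 * word_count 2 n.+1 (false, true) +
    2 * word_count 2 n (false, true).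
Proof.
have [] := word_count2_rec n; have [] := word_count2_rec n.+1.
lia.
Qed.

(** Here the weighted coefficients are [z + 2 z^2] and [2 z^3], with derivatives 5 and 6 at
    [z = 1]. *)
Lemma word_total2_rec2 n :
  word_total 2 n.+2 (false, true) =
    3 * word_total 2 n.+1 (false, true) +
    2 * word_total 2 n (false, true) +
    (5 * word_count 2 n.+1 (false, true) +
    6 * word_count 2 n (false, true)).
Proof.
have [] := word_count2_rec n; have [] := word_count2_rec n.+1.
have [] := word_total2_rec n; have [] := word_total2_rec n.+1.
lia.
Qed.

(** * Edges of the chain coded by a cycle and a bit position *)

Definition incident (s i k : nat) (n : nat) (v : 'I_n * 'I_4) : bool :=
  if k < 4 then
    (v.1 == i :> nat) && ((v.2 == k :> nat) || (v.2 == k.+1 %% 4 :> nat))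
  else (v.1 == i :> nat) && (v.2 == s :> nat)
    || (v.1 == i.+1 :> nat) && (v.2 == 0 :> nat).

(* For the last cycle, code 4 yields a singleton, which is not an edge; this
   keeps [edge_of] total and injective. *)
Definition edge_of (s : nat) {n : nat} (x : 'I_n * 'I_5) : {set 'I_n * 'I_4} :=
  [set v | incident s x.1 x.2 v].

(** Membership of the vertices of cycles [i] and [j] alone separates the two codes, which leaves a
    finite check. *)
Lemma edge_of_inj s n : 0 < s < 3 -> injective (@edge_of s n).
Proof.
move=> hs [i k] [j l] /setP E.
have E' (p : 'I_n) (q : nat) (hq : q < 4) :
    incident s i k (p, Ordinal hq) = incident s j l (p, Ordinal hq).
  by have := E (p, Ordinal hq); rewrite !inE.
have Ei q hq := E' i q hq; have Ej q hq := E' j q hq.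
move: (Ei 0 isT) (Ei 1 isT) (Ei 2 isT) (Ei 3 isT) => {Ei}.
move: (Ej 0 isT) (Ej 1 isT) (Ej 2 isT) (Ej 3 isT) => {Ej E E'}.
rewrite /incident /= !eqxx /=.
rewrite !(eq_sym (j : nat) (i : nat)) !(ltn_eqF (ltnSn _)).
have [ij|_] := eqVneq (i : nat) j.
  rewrite (val_inj ij) !(ltn_eqF (ltnSn _)) => E0 E1 E2 E3 _ _ _ _.
  congr (_, _); apply: val_inj; move: E0 E1 E2 E3.
  case: s hs => [|[|[|?]]] //= _; case: k => [] [|[|[|[|[|?]]]]] //= _;
    by case: l => [] [|[|[|[|[|?]]]]].
case: (i == j.+1 :> nat); case: (j == i.+1 :> nat).
all: case: s hs => [|[|[|?]]] //= _; case: k => [] [|[|[|[|[|?]]]]] //= ?.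
all: by case: l => [] [|[|[|[|[|?]]]]].
Qed.

Definition edge_code (n : nat) (x : 'I_n * 'I_5) : bool :=
  (x.2 < 4) || (x.1.+1 < n).

Lemma edge_of_edges s n (x : 'I_n * 'I_5) : 0 < s < 4 ->
  edge_code x -> edge_of s x \in edges (C4chain s n).
Proof.
move=> hs; case: x => i k; rewrite /edge_code /= inE => ek.
apply/existsP; have [k4|k4] := ltnP k 4.
  exists (i, Ordinal k4); apply/existsP; exists (i, inord (k.+1 %% 4)).
  apply/andP; split.
    rewrite /= /C4chain_adj /C4chain_arc /= !eqxx /= !inE !xpair_eqE /=.
    rewrite inordK ?ltn_mod //.
    by case: k {ek} k4 => [] [|[|[|[|?]]]] // ? ?; rewrite ?orbT.
  apply/eqP/setP => -[p q]; rewrite !inE /incident /= k4 !xpair_eqE -!val_eqE /=.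
  by rewrite inordK ?ltn_mod // andb_orr.
rewrite ltnNge k4 /= in ek; case/andP: hs => s0 s4.
exists (i, Ordinal s4); apply/existsP; exists (Ordinal ek, ord0).
apply/andP; split; first by rewrite /= /C4chain_adj /C4chain_arc /= !eqxx /= orbT.
by apply/eqP/setP => -[p q]; rewrite !inE /incident /= ltnNge k4 /= !xpair_eqE.
Qed.

Lemma C4chain_arc_edge s n (u v : 'I_n * 'I_4) : 0 < s < 4 ->
  C4chain_arc s u v -> exists2 x, edge_code x & [set u; v] = edge_of s x.
Proof.
case: u v => [i j] [p q] hs; rewrite /C4chain_arc /=.
have mk (k : 'I_5) : k < 4 ->
    [set (i, j); (i, q)] = [set v : 'I_n * 'I_4 |
      (v.1 == i) && ((v.2 == k :> nat) || (v.2 == k.+1 %% 4 :> nat))] ->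
    exists2 x, edge_code x & [set (i, j); (i, q)] = edge_of s x.
  move=> k4 ->; exists (i, k); first by rewrite /edge_code /= k4.
  by apply/setP => v; rewrite !inE /incident /= k4 -val_eqE.
case/orP => [/andP[/eqP <-]|/and3P[/eqP ip /eqP js /eqP q0]].
  rewrite !inE !xpair_eqE => /or4P[] /andP[/eqP hj /eqP hq];
    [apply: (mk (inord 0)) | apply: (mk (inord 1)) | apply: (mk (inord 2))
    | apply: (mk (inord 3))]; rewrite ?inordK //; apply/setP => -[a b];
    by rewrite !inE !xpair_eqE -!val_eqE /= hj hq andb_orr // orbC.
exists (i, ord_max); first by rewrite /edge_code /= ip.
apply/setP => -[a b].
by rewrite !inE /incident /= !xpair_eqE -!val_eqE /= -ip js q0.
Qed.

Lemma edgesP s n (e : {set C4chain s n}) : 0 < s < 4 ->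
  reflect (exists2 x, edge_code x & e = edge_of s x) (e \in edges (C4chain s n)).
Proof.
move=> hs; apply: (iffP idP) => [|[x hx ->]]; last exact: edge_of_edges.
rewrite inE => /existsP[u /existsP[v /andP[uv /eqP ->]]].
case/orP: uv => /(C4chain_arc_edge hs) //.
by rewrite setUC.
Qed.

(** * Words as edge sets, and vertex degrees *)

Definition block0 : block := (false, false, false, false, false).

Definition word_edges (s n : nat) (w : n.-tuple block) : {set {set C4chain s n}} :=
  edge_of s @: [set x : 'I_n * 'I_5 | bit (tnth w x.1) x.2].

Definition edges_word (s n : nat) (M : {set {set C4chain s n}}) : n.-tuple block :=
  let e i k := edge_of s (i, inord k) \in M in
  [tuple (e i 0, e i 1, e i 2, e i 3, e i 4) | i < n].

Lemma bit_edges_word s n (M : {set {set C4chain s n}}) (x : 'I_n * 'I_5) :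
  bit (tnth (edges_word M) x.1) x.2 = (edge_of s x \in M).
Proof.
case: x => i k; rewrite tnth_mktuple /=.
by case: k => [] [|[|[|[|[|?]]]]] //= hk; congr (edge_of _ (_, _) \in M);
  apply: val_inj; rewrite /= inordK.
Qed.

Lemma block_eq (a b : block) : (forall k : 'I_5, bit a k = bit b k) -> a = b.
Proof.
case: a b => [[[[a0 a1] a2] a3] a4] [[[[b0 b1] b2] b3] b4] H.
by move: (H (inord 0)) (H (inord 1)) (H (inord 2)) (H (inord 3)) (H (inord 4));
  rewrite !inordK //= => -> -> -> -> ->.
Qed.

Lemma word_edgesK s n : 0 < s < 3 -> cancel (@word_edges s n) (@edges_word s n).
Proof.
move=> hs w; apply: eq_from_tnth => i; apply: block_eq => k.
by rewrite (bit_edges_word _ (i, k)) mem_imset ?inE //; apply: edge_of_inj.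
Qed.

Lemma edges_wordK s n (M : {set {set C4chain s n}}) : 0 < s < 4 ->
  M \subset edges (C4chain s n) -> word_edges s (edges_word M) = M.
Proof.
move=> hs /subsetP sM; apply/setP => e; apply/imsetP/idP => [[x]|eM].
  by rewrite inE bit_edges_word => ? ->.
have /edgesP-/(_ hs) [x _ eE] := sM e eM; exists x => //.
by rewrite inE bit_edges_word -eE.
Qed.

Lemma sum_code n (F : 'I_n -> 'I_5 -> nat) :
  \sum_(x : 'I_n * 'I_5) F x.1 x.2 = \sum_i (F i (inord 0) + F i (inord 1) + F i (inord 2) +
    F i (inord 3) + F i (inord 4)).
Proof.
rewrite -(pair_bigA _ F) /=; apply: eq_bigr => i _.
rewrite !big_ord_recl big_ord0 addn0 !addnA.
by do !congr (_ + _); congr (F i _); apply: val_inj; rewrite /= inordK.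
Qed.

Lemma card_word_edges s n (w : n.-tuple block) : 0 < s < 3 ->
  #|word_edges s w| = word_size w.
Proof.
move=> hs; rewrite card_imset; last exact: edge_of_inj.
rewrite -sum1dep_card big_mkcond /=.
rewrite (eq_bigr (fun x : 'I_n * 'I_5 => (bit (tnth w x.1) x.2 : nat)));
  last by move=> x; case: bit.
rewrite (sum_code (fun i k => (bit (tnth w i) k : nat))) /word_size big_tuple.
by apply: eq_bigr => i _; rewrite /block_size !inordK.
Qed.

(** Prepending [block0] makes index [i] point to the block before cycle [i], with an empty block
    before the first cycle. *)
Definition word_deg (s : nat) (w : seq block) (i j : nat) : nat :=
  block_deg s (bit (nth block0 (block0 :: w) i) 4) (nth block0 w i) j.

(** By injectivity the edges at [v] can be counted by their codes. Only the block of the cycle of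
    [v] and the link of the preceding block contribute. *)
Lemma card_word_edges_at s n (w : n.-tuple block) (v : 'I_n * 'I_4) :
  0 < s < 3 ->
  #|[set e in word_edges s w | v \in e]| = word_deg s w v.1 v.2.
Proof.
move=> hs.
set A := [set x : 'I_n * 'I_5 | bit (tnth w x.1) x.2 && incident s x.1 x.2 v].
have -> : [set e in word_edges s w | v \in e] = edge_of s @: A.
  apply/setP => e; rewrite inE.
  apply/andP/imsetP => [[/imsetP[x xw ->] vx]|[x xA ->]].
    by exists x => //; rewrite !inE in xw vx *; rewrite xw vx.
  by move: xA; rewrite !inE => /andP[xw ->]; rewrite imset_f // inE.
rewrite card_imset; last exact: edge_of_inj.
rewrite -sum1dep_card big_mkcond /=.
rewrite (eq_bigr (fun x : 'I_n * 'I_5 =>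
  (bit (tnth w x.1) x.2 && incident s x.1 x.2 v : nat))); last by move=> x; case: andb.
rewrite (sum_code (fun i k => (bit (tnth w i) k && incident s i k v : nat))).
case: v A => p q _ /=.
pose C i := (q == 0 :> nat) * bit (tnth w i) 4.
rewrite (eq_bigr (fun i : 'I_n => (i == p) * block_deg s false (tnth w i) q +
   (p == i.+1 :> nat) * C i)); last first.
  move=> i _; rewrite !inordK // /incident /= /C /block_deg [i == p]eq_sym -val_eqE /= {C}.
  (* Records that [p = i] and [p = i + 1] exclude each other, so that the case split on both tests
     treats the impossible case too. *)
  have -> : (p == i.+1 :> nat) = (p == i.+1 :> nat) && (p != i :> nat).
    by case: eqP => //= ->; rewrite gtn_eqF.
  case: (p == i :> nat); case: (p == i.+1 :> nat) => /=;
    rewrite !(andbF, andbT, mul0n, mul1n, addn0).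
  1,2: by case: q => [] [|[|[|[|?]]]] //= _; case: s hs => [|[|[|?]]] //= _;
    case: (tnth w i) => [[[[[] []] []] []] []].
  - by rewrite !add0n andbC -mulnb.
  - by [].
rewrite big_split /= (bigD1 p) //= eqxx mul1n big1 => [|i /negPf ->];
  last by rewrite mul0n.
rewrite addn0 /word_deg (tnth_nth block0).
have -> : \sum_(i < n) (p == i.+1 :> nat) * C i =
    (q == 0 :> nat) * bit (nth block0 (block0 :: w) p) 4.
  case: p => [[|p] hp] /=; first by rewrite big1 ?muln0.
  rewrite (bigD1 (Ordinal (ltnW hp))) //= eqxx mul1n big1 /C => [|i ip].
    by rewrite addn0 (tnth_nth block0).
  by rewrite eqSS eq_sym; move: ip; rewrite -val_eqE /= => /negPf ->.
by rewrite /block_deg muln0 addn0.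
Qed.

(** * Maximal matchings as good words, and the invariants of the chain *)

Lemma good_wordP s c (w : seq block) :
  reflect ((forall i, i < size w ->
              fits s (nth c (c :: map (out_interface s) w) i) (nth block0 w i)) /\
           ~~ (last c (map (out_interface s) w)).1)
          (good_word s c w).
Proof.
elim: w c => [|b w IH] c /=; first by apply: (iffP idP) => [|[]].
have nthE i : i < size w -> nth c (out_interface s b :: map (out_interface s) w) i =
    nth (out_interface s b) (out_interface s b :: map (out_interface s) w) i.
  by move=> iw; apply: set_nth_default; rewrite /= size_map ltnW.
apply: (iffP andP) => [[fb /IH [fw lw]]|[fw lw]]; split=> //.
- by case=> [|i] //= iw; rewrite nthE // fw.
- exact: (fw 0).
- by apply/IH; split=> // i iw; rewrite -nthE //; apply: (fw i.+1).
Qed.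

Lemma out_interface_deg s (w : seq block) i : 0 < s ->
  (out_interface s (nth block0 w i)).2 = (0 < word_deg s w i s).
Proof. by case: s => // s _; rewrite /out_interface /word_deg /block_deg /= mul0n. Qed.

(** Once degrees are read from the word, the degree bounds and the domination of arcs match [fits]
    at each cycle. What remains is that all coded sets are edges, which amounts to the last link bit
    being unset. *)
Lemma maximal_word_edges s n (w : n.-tuple block) : 0 < s < 3 ->
  maximal_matching (word_edges s w) = good_word s (false, true) w.
Proof.
move=> hs; have hs4 : 0 < s < 4 by case/andP: hs => -> /ltnW.
have s0 : 0 < s by case/andP: hs.
have s4 : s < 4 by case/andP: hs4.
rewrite maximal_matchingE matchingE.
(* The disjunct [i == 0] reflects the initial interface [(false, true)], which imposes nothing on
   the first cycle. *)
have prevE i : i < n ->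
    nth (false, true) ((false, true) :: map (out_interface s) w) i =
    (bit (nth block0 (block0 :: w) i) 4, (i == 0) || (0 < word_deg s w i.-1 s)).
  case: i => [|i] // /ltnW hi; rewrite /= -out_interface_deg //.
  by rewrite (nth_map block0) ?size_tuple.
have fitsE i : i < n ->
    fits s (nth (false, true) ((false, true) :: map (out_interface s) w) i)
      (nth block0 w i) =
    [&& all (fun j => word_deg s w i j <= 1) (iota 0 4),
      all (fun j => (0 < word_deg s w i j) || (0 < word_deg s w i (j.+1 %% 4)))
        (iota 0 4) &
      [|| i == 0, 0 < word_deg s w i.-1 s | 0 < word_deg s w i 0]].
  by move=> hi; rewrite prevE // /fits /= orbA.
have lastE : (last (false, true) (map (out_interface s) w)).1 = bit (last block0 w) 4.
  by case: (tval w) => //= b w'; rewrite last_map.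
have covE (v : 'I_n * 'I_4) :
    (v \in cover (word_edges s w)) = (0 < word_deg s w v.1 v.2).
  rewrite -card_word_edges_at // card_gt0; apply/bigcupP/set0Pn => [[e eM ve]|[e]].
    by exists e; rewrite inE eM ve.
  by rewrite inE => /andP[eM ve]; exists e.
apply/idP/good_wordP; rewrite size_tuple lastE.
  case/andP => /andP[/subsetP sM /forallP dM] /forallP domM.
  have domA (u v : 'I_n * 'I_4) : C4chain_arc s u v ->
      (0 < word_deg s w u.1 u.2) || (0 < word_deg s w v.1 v.2).
    move=> uv; rewrite -!covE; apply: (implyP (forallP (domM u) v)).
    by rewrite /= /C4chain_adj uv.
  split=> [i hi|].
    rewrite fitsE //; apply/and3P; split.
    - apply/allP => j; rewrite mem_iota => /andP[_ hj].
      by have := dM (Ordinal hi, Ordinal hj); rewrite card_word_edges_at.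
    - have H j (hj : j < 4) k (hk : k < 4) :
          (j, k) \in [:: (0, 1); (1, 2); (2, 3); (0, 3)] ->
          (0 < word_deg s w i j) || (0 < word_deg s w i k).
        move=> jk; apply: (domA (Ordinal hi, Ordinal hj) (Ordinal hi, Ordinal hk)).
        by rewrite /C4chain_arc /= eqxx jk.
      rewrite /= (H 0 _ 1) // (H 1 _ 2) // (H 2 _ 3) //= andbT orbC.
      exact: (H 0 _ 3).
    - case: i hi => [|i] //= hi.
      apply: (domA (Ordinal (ltnW hi), Ordinal s4) (Ordinal hi, Ordinal (isT : 0 < 4))).
      by rewrite /C4chain_arc /= !eqxx orbT.
  case: n w {prevE fitsE lastE domA dM domM covE} sM => [|n] w sM;
    first by rewrite tuple0.
  (* If the last link bit were set, its singleton would be an edge and hence have a valid code; by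
     injectivity that code is the last link's, which is invalid. *)
  apply/negP => lw.
  have /edgesP-/(_ hs4) [x xc /(edge_of_inj hs) xE] :
      edge_of s (@ord_max n, @ord_max 4) \in edges (C4chain s n.+1).
    apply: sM; apply: imset_f; rewrite inE /= (tnth_nth block0) /=.
    by rewrite -nth_last size_tuple in lw.
  by move: xc; rewrite -xE /edge_code /= ltnn.
case=> fw lw; rewrite -andbA; apply/and3P; split.
- apply/subsetP => e /imsetP[[i k]]; rewrite inE /= => ik ->.
  apply: edge_of_edges => //; rewrite /edge_code /= ltnNge -implybE; apply/implyP => k4.
  have /eqP kE : k == 4 :> nat by rewrite eqn_leq k4 -ltnS ltn_ord.
  rewrite ltn_neqAle ltn_ord andbT; apply: contra lw => /eqP iE.
  have -> : last block0 w = nth block0 w i.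
    by rewrite -nth_last size_tuple; congr nth; rewrite -[in LHS]iE.
  by move: ik; rewrite kE (tnth_nth block0).
- apply/forallP => -[i j]; rewrite card_word_edges_at //.
  have := fw i (ltn_ord i); rewrite fitsE // => /and3P[/allP /(_ j) + _ _].
  by apply; rewrite mem_iota /=.
- have domA (u v : 'I_n * 'I_4) : C4chain_arc s u v ->
      (0 < word_deg s w u.1 u.2) || (0 < word_deg s w v.1 v.2).
    case: u v => [i j] [p q]; rewrite /C4chain_arc /=.
    have := fw i (ltn_ord i); rewrite fitsE // => /and3P[_ /= h _].
    case/orP => [/andP[/eqP <-]|/and3P[/eqP ip /eqP js /eqP q0]].
      case/and5P: h => h0 h1 h2 h3 _.
      rewrite !inE !xpair_eqE => /or4P[] /andP[/eqP -> /eqP ->] //.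
      by rewrite orbC.
    have := fw p (ltn_ord p); rewrite fitsE // => /and3P[_ _].
    by rewrite -ip js q0.
  apply/forallP => u; apply/forallP => v; apply/implyP.
  by rewrite !covE => /orP[/domA //|/domA]; rewrite orbC.
Qed.

Lemma reindex_maximal s n (F : {set {set C4chain s n}} -> nat) : 0 < s < 3 ->
  \sum_(M | maximal_matching M) F M =
  \sum_(w : n.-tuple block | good_word s (false, true) w) F (word_edges s w).
Proof.
move=> hs; rewrite (reindex_onto (@word_edges s n) (@edges_word s n)); last first.
  move=> M mM; apply: edges_wordK; first by case/andP: hs => -> /ltnW.
  by move: mM; rewrite maximal_matchingE => /andP[/andP[]].
by apply: eq_bigl => w; rewrite word_edgesK // eqxx andbT maximal_word_edges.
Qed.

Lemma T0_C4chain s n : 0 < s < 3 -> T0 (C4chain s n) = word_count s n (false, true).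
Proof.
by move=> hs; rewrite /T0 -sum1dep_card reindex_maximal // word_countE.
Qed.

Lemma T1_C4chain s n : 0 < s < 3 -> T1 (C4chain s n) = word_total s n (false, true).
Proof.
move=> hs; rewrite /T1 reindex_maximal // word_totalE.
by apply: eq_bigr => w _; rewrite card_word_edges.
Qed.

Lemma nu_C4chain s n : 0 < s < 3 -> nu (C4chain s n) = n.*2.
Proof.
move=> hs; apply/eqP; rewrite eqn_leq; apply/andP; split.
  apply/bigmax_leqP => M /card_matching_le.
  by rewrite /= card_prod !card_ord; lia.
(* Two opposite edges in every cycle form a perfect matching, which attains the upper bound. *)
pose b : block := (true, false, true, false, false).
pose w : n.-tuple block := [tuple of nseq n b].
have sw : #|word_edges s w| = n.*2.
  by rewrite card_word_edges // /word_size big_nseq iter_addn_0 /= mul2n.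
rewrite -sw; apply: (@leq_bigmax_cond _ (@matching _) (fun M => #|M|)).
suff : maximal_matching (word_edges s w) by rewrite maximal_matchingE => /andP[].
rewrite maximal_word_edges //= /w /=.
have fb : fits s (false, true) b && (out_interface s b == (false, true)).
  by case: s hs {w sw} => [|[|[|?]]].
by case/andP: fb => fb /eqP ob; elim: n {w sw} => //= n IH; rewrite fb ob.
Qed.

(* Limits of perturbed linear recurrences *)
From mathcomp Require Import all_classical all_reals all_analysis.
From mathcomp Require Import ring lra.
Import Order.TTheory GRing.Theory Num.Theory.
Import numFieldNormedType.Exports.
Local Open Scope classical_set_scope.
Local Open Scope ring_scope.

(** Once [g] is at most [e / 2 * (1 - t)], the bound [e / 2] is a fixed point of the affine
    majorant, so iteration leaves only [t ^+ k * m N] on top of it. *)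
Lemma cvg0_contraction (R : realType) (t : R) (m g : R^nat) :
  0 <= t < 1 -> (forall n, 0 <= m n) ->
  (forall n, m n.+1 <= t * m n + g n) ->
  g @ \oo --> 0 -> m @ \oo --> 0.
Proof.
move=> /andP[t0 t1] m0 mS g0; apply/cvgrPdist_le => e e0.
have t1' : 0 < 1 - t by rewrite subr_gt0.
have e2 : 0 < e / 2 by rewrite divr_gt0.
have /cvgrPdist_le /(_ _ (mulr_gt0 e2 t1')) [N _ gN] := g0.
have decay k : m (N + k)%N <= t ^+ k * m N + e / 2.
  elim: k => [|k IH]; first by rewrite addn0 expr0 mul1r; lra.
  rewrite addnS (le_trans (mS _)) //.
  have /= := gN (N + k)%N (leq_addr _ _); rewrite sub0r normrN => gk.
  have := ler_wpM2l t0 IH; have := ler_norm (g (N + k)%N).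
  rewrite exprS; lra.
have : (fun k => t ^+ k * m N) @ \oo --> 0 * m N.
  by apply: cvgMr_tmp; apply: cvg_expr; rewrite ger0_norm.
rewrite mul0r => /cvgrPdist_le /(_ _ e2) [K _ tK].
exists (N + K)%N => //= n /= Nn.
rewrite sub0r normrN ger0_norm // -(subnKC (leq_trans (leq_addr _ _) Nn)).
rewrite (le_trans (decay _)) //.
have /= := tK (n - N)%N; rewrite sub0r normrN.
rewrite leq_subRL ?(leq_trans (leq_addr _ _) Nn) //.
by move=> /(_ Nn) /(le_trans (ler_norm _)); lra.
Qed.

Lemma gt0_add_norm_lt1 (R : realType) (a b : R) :
  `|a| + `|b| < 1 -> 0 < 1 + a + b.
Proof. by have := ler_norm (- a); have := ler_norm (- b); rewrite !normrN; lra. Qed.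

(** The error [v] to the fixed point [L] obeys the same recurrence with forcing [f n - l], and a
    weighted norm of two consecutive errors contracts. *)
Lemma cvg_linear_recurrence2 (R : realType) (a b l : R) (u f : R^nat) :
  `|a| + `|b| < 1 ->
  (forall n, u n.+2 + a * u n.+1 + b * u n = f n) ->
  f @ \oo --> l -> u @ \oo --> l / (1 + a + b).
Proof.
move=> ab uE fl.
have [a0 b0] := (normr_ge0 a, normr_ge0 b).
have ab1 := gt0_add_norm_lt1 ab.
set L := l / _; have LE : (1 + a + b) * L = l by rewrite mulrC divfK // gt_eqF.
pose v n := u n - L.
(* The factor [t] is below 1 exactly when [k] lies strictly between [|b|] and [1 - |a|]; the
   midpoint is taken. *)
pose k := (1 - `|a| + `|b|) / 2; have k0 : 0 < k by rewrite /k; lra.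
have bk : `|b| / k < 1 by rewrite ltr_pdivrMr // /k; lra.
pose t := Num.max (`|a| + k) (`|b| / k).
pose m n := `|v n.+1| + k * `|v n|.
have m0 n : 0 <= m n by rewrite addr_ge0 // mulr_ge0 // ltW.
have cm : m @ \oo --> 0.
  apply: (@cvg0_contraction _ t m (fun n => `|f n - l|)) => //.
  - by rewrite le_max gt_max bk addr_ge0 ?(ltW k0) //= /k; lra.
  - move=> n; have -> : m n.+1 = `|(f n - l) - a * v n.+1 - b * v n| + k * `|v n.+1|.
      by rewrite /m -uE -LE /v; congr (`|_| + _); ring.
    have h1 : `|(f n - l) - a * v n.+1 - b * v n| <=
       `|f n - l| + `|a| * `|v n.+1| + `|b| * `|v n|.
      rewrite -!normrM (le_trans (ler_normB _ _)) // lerD2r.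
      exact: ler_normB.
    have ta : `|a| + k <= t by rewrite le_max lexx.
    have tb : `|b| <= t * k by rewrite -ler_pdivrMr // le_max lexx orbT.
    have := ler_wpM2r (normr_ge0 (v n.+1)) ta.
    have := ler_wpM2r (normr_ge0 (v n)) tb.
    by rewrite /m; lra.
  - rewrite -(normr0 R); apply: cvg_norm; rewrite -(subrr l).
    by apply: cvgB => //; exact: cvg_cst.
have cv : (fun n => v n.+1) @ \oo --> 0.
  have cz : (fun=> 0 : R) @ \oo --> (0 : R) by exact: cvg_cst.
  have : (fun n => `|v n.+1|) @ \oo --> (0 : R).
    apply: squeeze_cvgr cz cm.
    by near=> n; rewrite normr_ge0 /m lerDl mulr_ge0 // ltW.
  exact: norm_cvg0.
have cu : v @ \oo --> 0 by rewrite -cvg_shiftS.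
by apply: (@cvg_sub0 _ _ _ _ _ u (fun=> L)) => //; exact: cvg_cst.
Unshelve. all: by end_near. Qed.

(** The mean of the increments telescopes to [d n / n] up to a term in [d 0 / n], which vanishes. *)
Lemma cesaro_increments (R : realType) (d : R^nat) (l : R) :
  (fun n => d n.+1 - d n) @ \oo --> l -> (fun n => d n / n%:R) @ \oo --> l.
Proof.
move=> /cesaro h; rewrite -cvg_shiftS /=.
have c0 : (fun n => d 0%N * n.+1%:R^-1) @ \oo --> 0.
  by rewrite -(mulr0 (d 0%N)); apply: cvgMl_tmp; exact: cvg_harmonic.
rewrite -[l]addr0; apply: cvg_trans (cvgD h c0); apply: near_eq_cvg.
near=> n; rewrite /arithmetic_mean /= seriesEnat.
transitivity (n.+1%:R^-1 * \sum_(0 <= k < n.+1) (d k.+1 - d k)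
  + d 0%N / n.+1%:R) => //.
by rewrite telescope_sumr //; ring.
Unshelve. all: by end_near. Qed.

(* Dividing the recurrences by the factor [x - r] leaves contracting recurrences
   for [Y n / r ^+ n] and for the increments of [P n / r ^+ n]. *)
Lemma cvg_perturbed_recurrence3 (R : realType) (r c2 c1 c0 p2 p1 p0 : R)
    (Y P : R^nat) :
  0 < r -> r ^+ 3 = c2 * r ^+ 2 + c1 * r + c0 ->
  `|(r - c2) / r| + `|(r ^+ 2 - c2 * r - c1) / r ^+ 2| < 1 ->
  0 < Y 2%N + (r - c2) * Y 1%N + (r ^+ 2 - c2 * r - c1) * Y 0%N ->
  (forall n, Y n.+3 = c2 * Y n.+2 + c1 * Y n.+1 + c0 * Y n) ->
  (forall n, P n.+3 = c2 * P n.+2 + c1 * P n.+1 + c0 * P n +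
                      (p2 * Y n.+2 + p1 * Y n.+1 + p0 * Y n)) ->
  (fun n => P n / (n%:R * Y n)) @ \oo -->
    (p2 * r ^+ 2 + p1 * r + p0) / (r * (3 * r ^+ 2 - 2 * c2 * r - c1)).
Proof.
move=> r0 rE; set a := _ / r; set b := _ / r ^+ 2; set K := Y 2%N + _ + _ => ab K0 YE PE.
have r_neq0 : r != 0 by rewrite gt_eqF.
have rn_neq0 n : r ^+ n != 0 by rewrite expf_neq0.
have ab1 := gt0_add_norm_lt1 ab.
have c0E : c0 = r ^+ 3 - c2 * r ^+ 2 - c1 * r by rewrite rE; ring.
pose y n := Y n / r ^+ n; pose d n := P n / r ^+ n.
(* The quotient of the characteristic polynomial by [x - r], applied to [Y], is multiplied by [r] at
   each step; after division by powers of [r] it is constant. *)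
have yE n : y n.+2 + a * y n.+1 + b * y n = K / r ^+ 2.
  elim: n => [|n IH].
    by rewrite /y /a /b /K !expr2; field.
  rewrite -IH /y YE c0E /a /b !exprS; field.
  by rewrite r_neq0 rn_neq0.
have cy : y @ \oo --> K / r ^+ 2 / (1 + a + b).
  by apply: cvg_linear_recurrence2 ab yE _; exact: cvg_cst.
set l := K / r ^+ 2 / (1 + a + b) in cy.
(* Positivity of [K] ensures that [Y] really grows like [r ^+ n]. *)
have l0 : 0 < l by rewrite !divr_gt0 // exprn_gt0.
pose f n := p2 / r * y n.+2 + p1 / r ^+ 2 * y n.+1 + p0 / r ^+ 3 * y n.
have cf : f @ \oo --> p2 / r * l + p1 / r ^+ 2 * l + p0 / r ^+ 3 * l.
  have cy1 : (fun n => y n.+1) @ \oo --> l by rewrite cvg_shiftS.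
  have cy2 : (fun n => y n.+2) @ \oo --> l.
    by rewrite (cvg_shiftS (fun n => y n.+1)).
  by apply: cvgD; [apply: cvgD|]; apply: cvgMl_tmp.
have cd : (fun n => d n.+1 - d n) @ \oo -->
    (p2 / r * l + p1 / r ^+ 2 * l + p0 / r ^+ 3 * l) / (1 + a + b).
  apply: cvg_linear_recurrence2 ab _ cf => n.
  rewrite /d /f /y PE c0E /a /b !exprS; field.
  by rewrite r_neq0 rn_neq0.
have := cesaro_increments cd => cdn.
have -> : (p2 * r ^+ 2 + p1 * r + p0) / (r * (3 * r ^+ 2 - 2 * c2 * r - c1)) =
    (p2 / r * l + p1 / r ^+ 2 * l + p0 / r ^+ 3 * l) / (1 + a + b) / l.
  (* The left side is the derivative of the characteristic polynomial at [r], hence the value at [r]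
     of the quotient by [x - r]. *)
  have dE : 3 * r ^+ 2 - 2 * c2 * r - c1 = r ^+ 2 * (1 + a + b).
    by rewrite /a /b; field.
  by rewrite dE; field; rewrite r_neq0 !gt_eqF.
apply: cvg_trans (cvgM cdn (cvgV (lt0r_neq0 l0) cy)); apply: near_eq_cvg.
have y0 : \forall n \near \oo, 0 < y n by apply: (cvgr_gt _ cy).
near=> n.
have n0 : (n%:R : R) != 0 by rewrite pnatr_eq0 -lt0n; near: n; exists 1%N.
have yn : 0 < y n by near: n.
have Yn : Y n != 0 by apply: contraTneq yn => Yn; rewrite /y Yn mul0r ltxx.
by rewrite /d /y /=; field; rewrite n0 Yn rn_neq0.
Unshelve. all: by end_near. Qed.

Lemma cvg_avg_ratio (R : realType) s (l : R) : (0 < s < 3)%N ->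
  (fun n => (word_total s n (false, true))%:R /
            (n%:R * (word_count s n (false, true))%:R) : R) @ \oo --> l ->
  (fun n => avg_ratio R (C4chain s n)) @ \oo --> l / 2.
Proof.
move=> hs; set f := (f in f @ \oo --> _) => cl; rewrite mulrC.
have cf : (fun n => 2^-1 * f n) @ \oo --> 2^-1 * l by apply: cvgMl_tmp.
apply: cvg_trans cf; apply: near_eq_cvg; near=> n.
have n0 : (0 < n)%N by near: n; exists 1%N.
rewrite /avg_ratio nu_C4chain // double_eq0 gtn_eqF //.
rewrite T0_C4chain // T1_C4chain // -mul2n natrM -[2 * _ * _]mulrA [in RHS]invfM.
by rewrite /f mulrCA.
Unshelve. all: by end_near. Qed.

(** * The dominant roots and the two limits *)

(* With [t] the sum of the two cube roots, [t ^+ 3 = 4 * t + 5] and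
   [4 * (4 / 3) <= t ^+ 2], since the cube roots have product [4 / 3]. *)
Lemma cardano_root (R : realType)
    (r := 1 + ((45 + Num.sqrt 1257) / 18) `^ (3^-1)
            + ((45 - Num.sqrt 1257) / 18) `^ (3^-1) : R) :
  3 < r < 4 /\ r ^+ 3 = 3 * r ^+ 2 + 1 * r + 2.
Proof.
set q := Num.sqrt 1257 in r *.
have q0 : 0 <= q :> R by apply: sqrtr_ge0.
have q2 : q ^+ 2 = 1257 :> R by rewrite sqr_sqrtr ?ler0n.
set x := (45 + q) / 18 in r *; set y := (45 - q) / 18 in r *.
have x0 : 0 <= x by rewrite /x; lra.
have q45 : q <= 45 by rewrite -(@ler_pXn2r _ 2) ?nnegrE // q2; lra.
have y0 : 0 <= y by rewrite /y; lra.
have cube (z : R) : 0 <= z -> (z `^ 3^-1) ^+ 3 = z.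
  by move=> z0; rewrite -powR_mulrn ?powR_ge0 // -powRrM mulVf // powRr1.
move: (cube x x0) (cube y y0) (powR_ge0 x 3^-1) (powR_ge0 y 3^-1); rewrite /r.
move: (x `^ 3^-1) (y `^ 3^-1) => a b ax bx a0 b0.
(* Cubes are compared: [(45^2 - 1257) / 18^2 = 64 / 27]. *)
have ab : a * b = 4 / 3.
  apply: (@pexpIrn _ 3) => //; rewrite ?nnegrE ?mulr_ge0 //.
  transitivity ((45 ^+ 2 - q ^+ 2) / 18 ^+ 2); first by rewrite exprMn ax bx /x /y; field.
  by rewrite q2; field.
have t3 : (a + b) ^+ 3 = 4 * (a + b) + 5.
  have -> : (a + b) ^+ 3 = a ^+ 3 + b ^+ 3 + 3 * (a * b) * (a + b) by ring.
  by rewrite ax bx ab /x /y; field.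
have t2 : 16 / 3 <= (a + b) ^+ 2.
  have -> : (a + b) ^+ 2 = (a - b) ^+ 2 + 4 * (a * b) by ring.
  by rewrite ab; have := sqr_ge0 (a - b); lra.
have t0 : 0 <= a + b by rewrite addr_ge0.
rewrite -addrA; move: (a + b) t0 t2 t3 => t t0 t2 t3.
have t_gt2 : 2 < t by rewrite -(@ltr_pXn2r _ 2) ?nnegrE //; lra.
have t_lt3 : t < 3.
  rewrite ltNge; apply/negP => t_ge3.
  (* The cubic equation says that this product equals 5. *)
  have : 3 * 5 <= t * (t ^+ 2 - 4).
    apply: ler_pM => //; rewrite lerBrDr.
    have : 3 ^+ 2 <= t ^+ 2 by rewrite ler_pXn2r ?nnegrE.
    lra.
  have -> : t * (t ^+ 2 - 4) = t ^+ 3 - 4 * t by ring.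
  by rewrite t3; lra.
split; last first.
  have -> : (1 + t) ^+ 3 = t ^+ 3 + 3 * t ^+ 2 + 3 * t + 1 by ring.
  by rewrite t3; ring.
by apply/andP; split; lra.
Qed.

(** Provides the contraction hypothesis for both chains, where [c2 = 3]. Both terms are nonnegative
    and their sum falls short of 1 by [(3 r - e) / r^2], with [e = r^2 - 3 r - c < 3 < 3 r]. *)
Lemma dominant_root_contracting (R : realType) (r c : R) :
  3 < r < 4 -> 0 <= r ^+ 2 - 3 * r - c < 3 ->
  `|(r - 3) / r| + `|(r ^+ 2 - 3 * r - c) / r ^+ 2| < 1.
Proof.
move=> /andP[r3 r4] /andP[c0 c1].
have r0 : 0 < r by lra.
have a0 : 0 <= (r - 3) / r by rewrite divr_ge0 //; lra.
have b0 : 0 <= (r ^+ 2 - 3 * r - c) / r ^+ 2 by rewrite divr_ge0 ?sqr_ge0.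
rewrite !ger0_norm //.
have -> : (r - 3) / r + (r ^+ 2 - 3 * r - c) / r ^+ 2 =
    1 - (3 * r - (r ^+ 2 - 3 * r - c)) / r ^+ 2 by field; lra.
rewrite ltrBlDr ltrDl divr_gt0 ?exprn_gt0 //; lra.
Qed.

Theorem theorem5 (R : realType) :
  (let r : R := 1 + ((45 + Num.sqrt 1257) / 18) `^ (3^-1)
                  + ((45 - Num.sqrt 1257) / 18) `^ (3^-1) in
   (fun n : nat => avg_ratio R (C4chain 1 n)) @ \oo -->
     (6 * r ^+ 2 + r + 10) / (2 * (3 * r ^+ 2 + 2 * r + 6)))
  /\
  (let r' : R := (3 + Num.sqrt 17) / 2 in
   (fun n : nat => avg_ratio R (C4chain 2 n)) @ \oo -->
     (5 * r' + 6) / (2 * (3 * r' + 4))).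
Proof.
split; cbv zeta.
- have [] := cardano_root R; set r := 1 + _ + _ => /andP[r3 r4] rE.
  have -> : (6 * r ^+ 2 + r + 10) / (2 * (3 * r ^+ 2 + 2 * r + 6)) =
      (6 * r ^+ 2 + 1 * r + 10) / (r * (3 * r ^+ 2 - 2 * 3 * r - 1)) / 2.
    (* The cubic equation lowers the degree of the general denominator. *)
    have -> : r * (3 * r ^+ 2 - 2 * 3 * r - 1) = 3 * r ^+ 2 + 2 * r + 6.
      transitivity (3 * r ^+ 3 - 6 * r ^+ 2 - r); first by ring.
      by rewrite rE; ring.
    by rewrite mul1r -mulrA -invfM [2 * _]mulrC.
  have r0 : 0 < r by lra.
  have zE : r ^+ 2 - 3 * r - 1 = 2 / r.
    apply: (mulIf (lt0r_neq0 r0)); rewrite divfK ?lt0r_neq0 //.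
    by rewrite -[RHS](addrK (3 * r ^+ 2 + 1 * r)) [2 + _]addrC -rE; ring.
  apply: cvg_avg_ratio => //; apply: cvg_perturbed_recurrence3 rE _ _ _ _ => //.
  + apply: dominant_root_contracting; first by rewrite r3.
    by rewrite zE divr_ge0 ?ltr_pdivrMr //; lra.
  (* The initial values are [Y 0 = 1], [Y 1 = 2], [Y 2 = 8]. *)
  + have [X1 Y1 _] := word_count1_rec 0; have [_ Y2 _] := word_count1_rec 1.
    rewrite Y2 X1 Y1 zE /=.
    have : 0 < 2 / r by rewrite divr_gt0.
    lra.
  + by move=> n; rewrite word_count1_rec3; ring.
  + by move=> n; rewrite word_total1_rec3; ring.
- set r := _ / 2.
  have q2 : Num.sqrt 17 ^+ 2 = 17 :> R by rewrite sqr_sqrtr ?ler0n.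
  have q0 : 0 <= Num.sqrt 17 :> R by apply: sqrtr_ge0.
  have r2 : r ^+ 2 = 3 * r + 2 by rewrite /r exprMn sqrrD q2; field.
  have q3 : 3 < Num.sqrt 17 :> R by rewrite -(@ltr_pXn2r _ 2) ?nnegrE // q2; lra.
  have q5 : Num.sqrt 17 < 5 :> R by rewrite -(@ltr_pXn2r _ 2) ?nnegrE // q2; lra.
  have r34 : 3 < r < 4 by rewrite /r; apply/andP; split; lra.
  have r0 : 0 < r by case/andP: r34; lra.
  have -> : (5 * r + 6) / (2 * (3 * r + 4)) =
      (5 * r ^+ 2 + 6 * r + 0) / (r * (3 * r ^+ 2 - 2 * 3 * r - 2)) / 2.
    have -> : 3 * r ^+ 2 - 2 * 3 * r - 2 = 3 * r + 4 by rewrite r2; ring.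
    by field; rewrite !gt_eqF //; lra.
  apply: cvg_avg_ratio => //.
  (* The second-order recurrence, shifted by one index, is a third-order one with [c0 = p0 = 0]; the
     characteristic polynomial gains a factor [x]. *)
  apply: (@cvg_perturbed_recurrence3 _ r 3 2 0) => //.
  + by rewrite exprS {1}r2 mulrDr mulrCA -expr2; ring.
  + by apply: dominant_root_contracting => //; rewrite r2; lra.
  + have [X1 Y1] := word_count2_rec 0; have [_ Y2] := word_count2_rec 1.
    by rewrite Y2 X1 Y1 r2 /=; case/andP: r34; lra.
  + by move=> n; rewrite word_count2_rec2; ring.
  + by move=> n; rewrite word_total2_rec2; ring.
Qed.
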